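(* Let $(\mathcal A,\sigma)$ be an involutive ring. For all $M,N\in\mathrm{Mat}_2(\mathcal A)$, $$\mathrm{tr}(\sigma(MN))=\mathrm{tr}(\sigma(N)\cdot\sigma(M)).$$
   Context: An involutive ring $(\mathcal A,\sigma)$ is a unital (possibly noncommutative) ring $\mathcal A$ with an anti-involution $\sigma$, i.e. $\sigma$ is additive, $\sigma(ab)=\sigma(b)\sigma(a)$ and $\sigma(\sigma(a))=a$. For a $2\times2$ matrix $M=\begin{bmatrix}A&B\\C&D\end{bmatrix}$ over $\mathcal A$, $\sigma(M)$ denotes the entrywise application of $\sigma$ (no transposition), and $\mathrm{tr}(M)=A+D\in\mathcal A$. *)

(* Defs.v *)
From mathcomp Require Import all_boot all_algebra.

Set Implicit Arguments.
Unset Strict Implicit.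
Unset Printing Implicit Defensive.

Import GRing.Theory.
Local Open Scope ring_scope.

(* [pzRingType] is used rather than [nzRingType]: the zero ring is allowed. *)
Definition anti_involution (A : pzRingType) (sigma : A -> A) : Prop :=
  [/\ forall a b : A, sigma (a + b) = sigma a + sigma b,
      forall a b : A, sigma (a * b) = sigma b * sigma a
    & forall a : A, sigma (sigma a) = a].

(* Main.v *)
Require Import Defs.
From mathcomp Require Import all_boot all_algebra.
Import GRing.Theory.
Local Open Scope ring_scope.

(** Although [sigma] without transposition does not reverse matrix products,
    the trace only sees the diagonal: [\tr (M *m N)] sums [M i j * N j i] over
    all pairs [(i, j)], and [sigma] turns each summand into
    [sigma (N j i) * sigma (M i j)], a summand of the trace of the reversed
    product. Exchanging the two summations puts these summands in the right
    order. The same computation applies to rectangular [M] and [N] of opposite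
    shapes, which is the form proved in [mxtrace_map_anti_involution]. *)

Lemma additive_sum (U V : zmodType) (f : U -> V)
    (fD : forall a b, f (a + b) = f a + f b)
    (I : Type) (r : seq I) (P : pred I) (F : I -> U) :
  f (\sum_(i <- r | P i) F i) = \sum_(i <- r | P i) f (F i).
Proof.
have f0 : f 0 = 0 by apply: (addrI (f 0)); rewrite -fD !addr0.
exact: (big_morph f fD f0).
Qed.

Lemma mxtrace_map_anti_involution (A : pzRingType) (sigma : A -> A)
    (hsigma : anti_involution sigma) (m n : nat)
    (M : 'M[A]_(m, n)) (N : 'M[A]_(n, m)) :
  \tr (map_mx sigma (M *m N)) = \tr (map_mx sigma N *m map_mx sigma M).
Proof.
case: hsigma => sigmaD sigmaM _.
rewrite /mxtrace.
under eq_bigr do rewrite !mxE additive_sum //.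
under [RHS]eq_bigr do rewrite !mxE.
rewrite exchange_big; apply: eq_bigr => j _; apply: eq_bigr => i _.
by rewrite sigmaM !mxE.
Qed.

Theorem proposition3p3 (A : pzRingType) (sigma : A -> A)
    (hsigma : anti_involution sigma) (M N : 'M[A]_2) :
  \tr (map_mx sigma (M *m N)) = \tr (map_mx sigma N *m map_mx sigma M).
Proof. exact: mxtrace_map_anti_involution. Qed.
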